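(* Let $k,s\ge 1$ be integers and $n=2ks$. Let $A\in\mathbb C^{n\times n}$ be such that $A=G^T+[I_k,0]^TZ^H$, where $Z\in\mathbb C^{n\times k}$ and $G\in\mathbb C^{n\times n}$ is a unitary matrix that is CMV structured with block size $k$. Let $G=G_1G_2$ be a CMV factorization of $G$. Then $A$ can be represented in the LFR format as $$A=G_2^T\bigl(I_n+[I_k,0]^T\widehat Z^H\bigr)G_1^T,$$ where $L=G_2^T$, $R=G_1^T$, $F=I_n+[I_k,0]^T\widehat Z^H$ and $\widehat Z^H=Z^H\overline{G_1}$.
   Context: Notation: $M^T$, $M^H$, $\overline M$ are the transpose, conjugate transpose and entrywise complex conjugate; $[I_k,0]^T\in\mathbb C^{n\times k}$ consists of the first $k$ columns of $I_n$. A matrix is upper (lower) Hessenberg if its $(i,j)$ entry vanishes for $i>j+1$ (for $j>i+1$). LFR format: a matrix $A\in\mathbb C^{n\times n}$ is represented in the LFR format (with parameter $k$) by a triple $(L,F,R)$ of $n\times n$ matrices if (1) $A=LFR$; (2) $L$ is the product of $k$ unitary lower Hessenberg matrices; (3) $R$ is the product of $k$ unitary upper Hessenberg matrices; (4) $F=Q+[I_k,0]^TY^H$ for some $Y\in\mathbb C^{n\times k}$, where $Q=\begin{bmatrix}I_k&0\\0&\hat Q\end{bmatrix}$ is block diagonal unitary with $\hat Q$ unitary Hessenberg. CMV structure: let $n=2ks$ and partition $G\in\mathbb C^{n\times n}$ into $2s\times 2s$ blocks $G^{[p,q]}$ of size $k\times k$. A unitary $G$ is called CMV structured with block size $k$ if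 it has the block shape $$G=\begin{bmatrix}\times&\times&L_3\\ R_1&\times&\times\\ &\times&\times&\times&L_5\\ &R_2&\times&\times&\times\\ &&&\times&\times\\ &&&R_4&\times&\ddots\\ &&&&\ddots&\ddots\end{bmatrix},$$ where blank blocks are zero, $\times$ denotes an arbitrary $k\times k$ block, the $R_i$ are nonsingular upper triangular and the $L_i$ are nonsingular lower triangular. Explicitly (with blocks of index exceeding $2s$ discarded): block rows $1$ and $2$ are zero outside block columns $1,2,3$; for $2\le j\le s$, block rows $2j-1$ and $2j$ are zero outside block columns $2j-2,\dots,2j+1$; $G^{[2j-1,2j+1]}=L_{2j+1}$ for $1\le j\le s-1$; $G^{[2,1]}=R_1$; $G^{[2j,2j-2]}=R_{2j-2}$ for $2\le j\le s$. CMV factorization: a factorization $G=G_1G_2$ into block diagonal unitary matrices $G_1=\operatorname{diag}(G_{1,1},\ldots,G_{1,s})$, $G_2=\operatorname{diag}(I_k,G_{2,2},\ldots,G_{2,s+1})$, where $G_{2,s+1}$ is $k\times k$ and all other blocks $G_{i,j}$ are $2k\times 2k$, have bandwidth $k$ (the $(p,q)$ entry vanishes for $|p-q|>k$), and have both $G_{i,j}(k+1:2k,1:k)$ and $G_{i,j}(1:k,k+1:2k)$ triangular of full rank. Every unitary matrix $G\in\mathbb C^{n\times n}$, $n=2ks$, that is CMV structured with block size $k$ admits such a factorization. *)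

(* Defs.v *)
From mathcomp Require Import all_boot all_order all_algebra.

Set Implicit Arguments.
Unset Strict Implicit.
Unset Printing Implicit Defensive.

Import GRing.Theory Num.Theory.
Local Open Scope ring_scope.
Local Open Scope sesquilinear_scope.

Definition upper_triangular (T : nmodType) n (M : 'M[T]_n) : bool :=
  is_trig_mx M^T.

Definition lower_triangular (T : nmodType) n (M : 'M[T]_n) : bool :=
  is_trig_mx M.

Definition triangular (T : nmodType) n (M : 'M[T]_n) : bool :=
  upper_triangular M || lower_triangular M.

Definition upper_hessenberg (T : nmodType) n (M : 'M[T]_n) : Prop :=
  forall i j : 'I_n, (j.+1 < i)%N -> M i j = 0.

Definition lower_hessenberg (T : nmodType) n (M : 'M[T]_n) : Prop :=
  forall i j : 'I_n, (i.+1 < j)%N -> M i j = 0.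

(* The subtractions are truncated: the condition reads |i - j| > k. *)
Definition bandwidth_le (T : nmodType) k n (M : 'M[T]_n) : Prop :=
  forall i j : 'I_n, ((k < i - j) || (k < j - i))%N -> M i j = 0.

Section Formats.
Context {C : numClosedFieldType}.

Definition unitary_hessenberg_product
    (hess : forall n, 'M[C]_n -> Prop) k n (M : 'M[C]_n) : Prop :=
  exists H : 'I_k -> 'M[C]_n,
    (forall i, H i \is unitarymx /\ hess n (H i)) /\
    M = \big[mulmx/1%:M]_(i < k) H i.

(* "Hessenberg" without qualification means upper Hessenberg.  For k <= n, the
   matrix pid_mx k : 'M_(n, k) consists of the first k columns of 1%:M. *)
Definition is_LFR k n (A L F R : 'M[C]_n) : Prop :=
  [/\ A = L *m F *m R,
      unitary_hessenberg_product (@lower_hessenberg C) k L,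
      unitary_hessenberg_product (@upper_hessenberg C) k R &
      exists (m : nat) (e : (k + m = n)%N) (Q : 'M[C]_n) (Qhat : 'M[C]_m)
             (Y : 'M[C]_(n, k)),
        [/\ Q = castmx (e, e) (block_mx 1%:M 0 0 Qhat),
            Q \is unitarymx,
            Qhat \is unitarymx,
            upper_hessenberg Qhat &
            F = Q + pid_mx k *m Y^t*]].

(* The i-th block row (counting from 1) has 0-based index p with p.+1 = i, and
   similarly for columns.  For j = 1 the third clause leaves the block columns
   0, 1, 2, 3 free, that is, the actual columns 1, 2, 3. *)
Definition cmv_structured k s n (G : 'M[C]_n) : Prop :=
  exists (e : (\sum_(p < 2 * s) k = n)%N)
         (B : 'I_(2 * s) -> 'I_(2 * s) -> 'M[C]_k),
    [/\ G \is unitarymx,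
        G = castmx (e, e) (\mxblock_(p < 2 * s, q < 2 * s) B p q),
        forall (j : nat) (p q : 'I_(2 * s)), (1 <= j <= s)%N ->
          p.+1 = (2 * j - 1)%N \/ p.+1 = (2 * j)%N ->
          ~~ (2 * j - 2 <= q.+1 <= 2 * j + 1)%N ->
          B p q = 0,
        forall (j : nat) (p q : 'I_(2 * s)), (1 <= j <= s - 1)%N ->
          p.+1 = (2 * j - 1)%N -> q.+1 = (2 * j + 1)%N ->
          lower_triangular (B p q) /\ B p q \in unitmx &
        (forall p q : 'I_(2 * s), p.+1 = 2%N -> q.+1 = 1%N ->
          upper_triangular (B p q) /\ B p q \in unitmx) /\
        (forall (j : nat) (p q : 'I_(2 * s)), (2 <= j <= s)%N ->
          p.+1 = (2 * j)%N -> q.+1 = (2 * j - 2)%N ->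
          upper_triangular (B p q) /\ B p q \in unitmx)].

Definition cmv_factor_block k (M : 'M[C]_(k + k)) : Prop :=
  [/\ bandwidth_le k M,
      triangular (dlsubmx M), \rank (dlsubmx M) = k,
      triangular (ursubmx M) & \rank (ursubmx M) = k].

(* D1 lists G_{1,1}, ..., G_{1,s}; D2 lists G_{2,2}, ..., G_{2,s}; and E is the
   k x k block G_{2,s+1}. *)
Definition cmv_factorization k s n (G G1 G2 : 'M[C]_n) : Prop :=
  exists (D1 : 'I_s -> 'M[C]_(k + k)) (D2 : 'I_(s - 1) -> 'M[C]_(k + k))
         (E : 'M[C]_k)
         (e1 : (\sum_(i < s) (k + k) = n)%N)
         (e2 : (k + (\sum_(i < s - 1) (k + k) + k) = n)%N),
    [/\ G = G1 *m G2,
        G1 \is unitarymx /\ G2 \is unitarymx,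
        G1 = castmx (e1, e1) (\mxdiag_(i < s) D1 i),
        G2 = castmx (e2, e2)
               (block_mx 1%:M 0 0 (block_mx (\mxdiag_(i < s - 1) D2 i) 0 0 E)) &
        (forall i, cmv_factor_block (D1 i)) /\
        (forall i, cmv_factor_block (D2 i))].

End Formats.

(* Main.v *)
(* Transposing G = G1 G2 and using that G2^T fixes the first k columns of the
   identity gives A = G2^T (1 + [I_k, 0]^T Z^H conj(G1)) G1^T.  For the factors
   L and R, both G1 and G2 have bandwidth k, and any unitary matrix of lower
   bandwidth k >= 1 is a product of k unitary upper Hessenberg matrices: a
   sweep of Givens rotations down the outermost subdiagonal lowers the bandwidth
   by one, and the inverse of the product of the rotations is upper Hessenberg. *)
Require Import Defs.
From HB Require Import structures.
From mathcomp Require Import all_boot all_order all_algebra.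
From mathcomp Require Import reals complex zify.

Set Implicit Arguments.
Unset Strict Implicit.
Unset Printing Implicit Defensive.

Import Order.TTheory GRing.Theory Num.Theory.
Local Open Scope ring_scope.
Local Open Scope sesquilinear_scope.

Definition lower_bandwidth_le (T : nmodType) k n (M : 'M[T]_n) : Prop :=
  forall i j : 'I_n, (j + k < i)%N -> M i j = 0.

(** Makes the big-operator lemmas for monoid laws, such as [big_ord_recr], apply to products of
    matrices. *)
HB.instance Definition _ (R : pzSemiRingType) n :=
  Monoid.isLaw.Build 'M[R]_n 1%:M mulmx
    (@mulmxA R n n n n) (@mul1mx R n n) (@mulmx1 R n n).

Section Givens.
Context {C : numClosedFieldType}.

Lemma unitarymx1 n : (1%:M : 'M[C]_n) \is unitarymx.
Proof. by apply/unitarymxP; rewrite trmx1 map_mx1 mulmx1. Qed.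

Definition givens n (p q : 'I_n) (c s : C) : 'M[C]_n :=
  \matrix_(i, j) if i == p then c *+ (j == p) + s *+ (j == q)
    else if i == q then - s^* *+ (j == p) + c^* *+ (j == q)
    else (i == j)%:R.

Lemma mul_givensE n (p q : 'I_n) (c s : C) m (V : 'M[C]_(n, m)) i j :
  (givens p q c s *m V) i j =
    if i == p then c * V p j + s * V q j
    else if i == q then - s^* * V p j + c^* * V q j
    else V i j.
Proof.
have sumE (x : C) r : \sum_l x *+ (l == r) * V l j = x * V r j.
  rewrite (bigD1 r) //= eqxx big1 ?addr0 // => l /negPf ->.
  by rewrite mul0r.
rewrite mxE; under eq_bigr do rewrite mxE.
case: ifP => _; first by under eq_bigr do rewrite mulrDl; rewrite big_split /= !sumE.
case: ifP => _; first by under eq_bigr do rewrite mulrDl; rewrite big_split /= !sumE.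
by under eq_bigr do rewrite eq_sym; rewrite sumE mul1r.
Qed.

Lemma givens_unitary n (p q : 'I_n) (c s : C) :
  p != q -> c * c^* + s * s^* = 1 -> givens p q c s \is unitarymx.
Proof.
move=> pq cs1; have qp : q != p by rewrite eq_sym.
apply/unitarymxP/matrixP => i j; rewrite mul_givensE !mxE !eqxx (negPf pq) (negPf qp).
case: (eqVneq i p) => [eip|ip]; [|case: (eqVneq i q) => [eiq|iq]];
  (case: (eqVneq j p) => [ejp|jp]; [|case: (eqVneq j q) => [ejq|jq]]); subst;
  rewrite ?eqxx ?(negPf pq) ?(negPf qp) ?mulr0n ?mulr1n ?addr0 ?add0r
          ?rmorphN ?rmorph0 ?mulr0 ?addr0 /= ?conjCK //.
- by rewrite mulrN mulrC addrC subrr.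
- by rewrite eq_sym (negPf jp).
- by rewrite mulNr mulrC addrC subrr.
- by rewrite mulrNN addrC mulrC [s^* * _]mulrC.
- by rewrite eq_sym (negPf jq).
- by rewrite (negPf ip).
- by rewrite (negPf iq).
- by rewrite rmorph_nat eq_sym.
Qed.

(** With [r] the norm of [(a, b)], take [c = a^* / r] and [s = b^* / r]. For [b = 0] the identity is
    taken, which covers [r = 0]. *)
Lemma annihilating_rotation (a b : C) :
  exists c s : C, c * c^* + s * s^* = 1 /\ - s^* * a + c^* * b = 0.
Proof.
have [->|b0] := eqVneq b 0.
  by exists 1, 0; rewrite !rmorph1 !rmorph0 oppr0 !mulr0 mul0r mulr1 !addr0.
set r := sqrtC (a * a^* + b * b^*).
have sum_gt0 : 0 < a * a^* + b * b^*.
  by rewrite ltr_wpDl ?mul_conjC_ge0 ?mul_conjC_gt0.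
have r_neq0 : r != 0 by rewrite sqrtC_eq0 gt_eqF.
have rr : r^* = r by apply: conj_Creal; rewrite ger0_real ?sqrtC_ge0 ?ltW.
exists (a^* / r), (b^* / r); rewrite !rmorphM /= !fmorphV /= !conjCK rr.
split.
  rewrite !mulf_div -mulrDl -expr2 sqrtCK ![_^* * _]mulrC.
  by rewrite divff ?gt_eqF.
by rewrite mulNr mulrAC [X in _ + X]mulrAC [b * a]mulrC addrC subrr.
Qed.

(* One sweep of Givens rotations down the outermost subdiagonal: the rotation
   acting on rows t + k and t + k + 1 annihilates the entry (t + k + 1, t), and
   the first t rotations leave the rows of index above t + k untouched. *)
Lemma lower_bandwidth_reduce k n (M : 'M[C]_n) :
  lower_bandwidth_le k.+1 M ->
  exists W : 'M[C]_n, [/\ W \is unitarymx, lower_hessenberg W &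
    lower_bandwidth_le k (W *m M)].
Proof.
move=> Mbw.
(* After [t] rotations the columns before [t] are cleared. The rows of [W] beyond [t + k] are still
   those of the identity, which keeps [W] lower Hessenberg at the next rotation. *)
suff sweep (t : nat) : exists W : 'M[C]_n,
    [/\ W \is unitarymx, lower_hessenberg W,
      (forall i j : 'I_n, (t + k < i)%N -> W i j = (i == j)%:R),
      lower_bandwidth_le k.+1 (W *m M) &
      (forall i j : 'I_n, (j < t)%N -> (j + k < i)%N -> (W *m M) i j = 0)].
  have [W [Wu Wh _ _ WM0]] := sweep n.
  by exists W; split=> // i j; apply: WM0.
elim: t => [|t [W [Wu Wh Wid WMbw WM0]]].
  exists 1%:M; split=> [|i j lij|i j _||//]; rewrite ?mul1mx //.
  - exact: unitarymx1.
  - by rewrite mxE -val_eqE /= ltn_eqF // ltnW.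
  - by rewrite mxE.
(* If [n <= t + k + 1], no row lies below [t + k], so column [t] has nothing to annihilate. *)
have [tkn|ntk] := ltnP (t + k).+1 n; last first.
  exists W; split=> // [i j lti|i j jt ji]; first by apply: Wid; lia.
  by apply: WM0 => //; have := ltn_ord i; lia.
pose p := Ordinal (ltnW tkn); pose q := Ordinal tkn.
have tn : (t < n)%N by lia.
pose r := Ordinal tn.
have pq : p != q by rewrite -val_eqE /= ltn_eqF.
have [c [s [cs1 cs0]]] := annihilating_rotation ((W *m M) p r) ((W *m M) q r).
have Wrow (i j : 'I_n) : (p < i)%N -> W i j = (i == j)%:R by apply: Wid.
exists (givens p q c s *m W); rewrite -mulmxA.
set V := W *m M in WMbw WM0 cs0 *; split.
- by rewrite mul_unitarymx ?givens_unitary.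
(* Row [q = p + 1] of [W] is a row of the identity and row [p] vanishes beyond column [q], so their
   combinations vanish there too. *)
- move=> i j lij; rewrite mul_givensE.
  case: eqP => [ip|_]; [|case: eqP => [iq|_]]; last exact: Wh.
    move: lij; rewrite ip => lpj; rewrite (Wh p j) // (Wrow q) //= -val_eqE /=.
    by rewrite ltn_eqF // !mulr0 addr0.
  move: lij; rewrite iq /= => lqj.
  by rewrite (Wh p j) ?(Wrow q) //= -?val_eqE /= ?ltn_eqF ?mulr0 ?addr0 //; lia.
- move=> i j lti; rewrite mul_givensE.
  have -> : (i == p) = false by rewrite -val_eqE /=; lia.
  have -> : (i == q) = false by rewrite -val_eqE /=; lia.
  by apply: Wid; lia.
(* In rows [p] and [q], the positions outside bandwidth [k + 1] lie in columns before [t], where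
   both rows are already zero. *)
- move=> i j lij; rewrite mul_givensE.
  case: eqP => [ip|_]; [|case: eqP => [iq|_]]; last exact: WMbw.
    by move: lij; rewrite ip /= => ljt; rewrite !WM0 ?mulr0 ?addr0 //=; lia.
  by move: lij; rewrite iq /= => ljt; rewrite !WM0 ?mulr0 ?addr0 //=; lia.
(* In column [t], the choice of [c] and [s] clears row [q]; the rows below are outside bandwidth
   [k + 1]. *)
- move=> i j; rewrite ltnS leq_eqVlt => /predU1P[jt|jt] lij.
    have -> : j = r by apply: val_inj.
    rewrite mul_givensE; case: eqP => [ip|nip]; first by move: lij; rewrite ip jt ltnn.
    case: eqP => [//|niq]; apply: WMbw => /=.
    by move: nip niq => /eqP + /eqP; rewrite -!val_eqE /=; lia.
  rewrite mul_givensE.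
  case: eqP => [ip|_]; [|case: eqP => [iq|_]]; last exact: WM0.
    by rewrite !WM0 ?mulr0 ?addr0 //=; lia.
  by rewrite !WM0 ?mulr0 ?addr0 //=; lia.
Qed.

Lemma unitary_upper_hessenberg_product k n (M : 'M[C]_n) :
  (0 < k)%N -> M \is unitarymx -> lower_bandwidth_le k M ->
  unitary_hessenberg_product (@upper_hessenberg C) k M.
Proof.
(* The induction starts at bandwidth 1, where [M] is itself upper Hessenberg. *)
case: k => // k _; elim: k M => [|k IHk] M Mu Mbw.
  exists (fun=> M); split=> [_|]; last by rewrite big_ord1.
  by split=> // i j; rewrite -addn1; apply: Mbw.
have [W [Wu Wh /IHk[|H [Hu WM]]]] := lower_bandwidth_reduce Mbw.
  exact: mul_unitarymx.
(* [W^t*] becomes the factor of index 0, and [H] is shifted by one. *)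
exists (fun i => oapp H (W^t*) (unlift ord0 i)); split=> [i|]; last first.
  rewrite big_ord_recl unlift_none; under eq_bigr do rewrite liftK.
  by rewrite /= -WM mulmxA -[X in _ *m X *m _]trmxCK (unitarymxP _) ?mul1mx ?trmxC_unitary.
case: unliftP => [j _|_] //=; split; first by rewrite trmxC_unitary.
by move=> a b lab; rewrite !mxE Wh // rmorph0.
Qed.

(** Transposition reverses the order of the factors, hence [rev_ord], and swaps the two Hessenberg
    shapes. *)
Lemma unitary_hessenberg_product_tr k n (M : 'M[C]_n) :
  unitary_hessenberg_product (@upper_hessenberg C) k M ->
  unitary_hessenberg_product (@lower_hessenberg C) k M^T.
Proof.
case=> H [Hu ->]; exists (fun i => (H (rev_ord i))^T); split=> [i|].
  have [Hi_u Hi_h] := Hu (rev_ord i); split; first by rewrite trmx_unitary.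
  by move=> a b lab; rewrite mxE Hi_h.
elim: k H {Hu} => [|k IHk] H; first by rewrite !big_ord0 trmx1.
rewrite big_ord_recl big_ord_recr /= trmx_mul IHk; congr (_ *m _).
  by apply: eq_bigr => i _; congr (H _)^T; apply: val_inj; rewrite /= /bump; have := ltn_ord i; lia.
by congr (H _)^T; apply: val_inj; rewrite /= subnn.
Qed.
End Givens.

Section Bandwidth.
Context {T : nmodType}.

Lemma bandwidth_le_lower k n (M : 'M[T]_n) :
  bandwidth_le k M -> lower_bandwidth_le k M.
Proof. by move=> Mbw i j lij; apply: Mbw; apply/orP; left; lia. Qed.

Lemma bandwidth_le_tr k n (M : 'M[T]_n) : bandwidth_le k M -> bandwidth_le k M^T.
Proof. by move=> Mbw i j lij; rewrite mxE Mbw // orbC. Qed.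

Lemma bandwidth_le_cast k m n (e : m = n) (M : 'M[T]_m) :
  bandwidth_le k M -> bandwidth_le k (castmx (e, e) M).
Proof. by case: n / e; rewrite castmx_id. Qed.

(** Serves for the [k] x [k] corner blocks of [G2] and for the empty block diagonal. *)
Lemma bandwidth_le_small k n (M : 'M[T]_n) : (n <= k.+1)%N -> bandwidth_le k M.
Proof. by move=> lenk i j; have := ltn_ord i; have := ltn_ord j; lia. Qed.

Lemma bandwidth_le_block_diag k m n (M : 'M[T]_m) (N : 'M[T]_n) :
  bandwidth_le k M -> bandwidth_le k N -> bandwidth_le k (block_mx M 0 0 N).
Proof.
move=> Mbw Nbw i j; case: (split_ordP i) (split_ordP j) => a -> [] b -> /= lab;
  rewrite ?block_mxEul ?block_mxEur ?block_mxEdl ?block_mxEdr ?mxE //.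
  exact: Mbw.
by apply: Nbw; move: lab; rewrite !subnDl.
Qed.

Lemma bandwidth_le_mxdiag k m (p : 'I_m -> nat) (B : forall i, 'M[T]_(p i)) :
  (forall i, bandwidth_le k (B i)) -> bandwidth_le k (\mxdiag_i B i).
Proof.
elim: m p B => [|m IHm] p B Bbw.
  by apply: bandwidth_le_small; rewrite big_ord0.
rewrite mxdiag_recl; apply/bandwidth_le_cast/bandwidth_le_block_diag => //.
exact: IHm.
Qed.
End Bandwidth.

Lemma castmx_scalar (R : pzSemiRingType) m n (e : m = n) (a : R) :
  castmx (e, e) a%:M = a%:M.
Proof. by case: n / e; rewrite castmx_id. Qed.

(** [pid_mx k] is the block column [1%:M] over [0], which meets only the first block column. *)
Lemma mul_block_diag1_pid (R : pzSemiRingType) k m n (e : (k + m = n)%N)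
    (B : 'M[R]_m) :
  castmx (e, e) (block_mx 1%:M 0 0 B) *m pid_mx k = pid_mx k :> 'M_(n, k).
Proof.
case: n / e; rewrite castmx_id pid_mx_col mul_block_col.
by rewrite !mulmx0 mul1mx mul0mx !addr0.
Qed.

Theorem theorem2p5 (R : realType) (k s : nat) (hk : (1 <= k)%N) (hs : (1 <= s)%N)
    (A G G1 G2 : 'M[R[i]]_(2 * k * s)) (Z : 'M[R[i]]_(2 * k * s, k))
    (hA : A = G^T + pid_mx k *m Z^t*)
    (hGu : G \is unitarymx)
    (hG : cmv_structured k s G)
    (hfact : cmv_factorization k s G G1 G2) :
  exists Zhat : 'M[R[i]]_(2 * k * s, k),
    [/\ Zhat^t* = Z^t* *m map_mx Num.conj G1,
        A = G2^T *m (1%:M + pid_mx k *m Zhat^t*) *m G1^T &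
        is_LFR k A G2^T (1%:M + pid_mx k *m Zhat^t*) G1^T].
Proof.
case: hfact => D1 [D2 [E [e1 [e2 [GE [G1u G2u] G1E G2E [D1f D2f]]]]]].
have G1bw : bandwidth_le k G1.
  rewrite G1E; apply/bandwidth_le_cast/bandwidth_le_mxdiag => i.
  by have [] := D1f i.
have G2bw : bandwidth_le k G2.
  rewrite G2E; apply/bandwidth_le_cast/bandwidth_le_block_diag.
    exact: bandwidth_le_small.
  apply: bandwidth_le_block_diag; last exact: bandwidth_le_small.
  by apply: bandwidth_le_mxdiag => i; have [] := D2f i.
have G2pid : G2^T *m pid_mx k = pid_mx k :> 'M_(_, k).
  by rewrite G2E trmx_cast /= tr_block_mx !trmx0 trmx1 mul_block_diag1_pid.
exists ((Z^t* *m map_mx Num.conj G1)^t*); rewrite trmxCK.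
have AE : A = G2^T *m (1%:M + pid_mx k *m (Z^t* *m map_mx Num.conj G1)) *m G1^T.
  rewrite mulmxDr mulmx1 mulmxDl -trmx_mul -GE !mulmxA G2pid -!mulmxA.
  (* This is the transpose of [G1 *m G1^t* = 1%:M]. *)
  have -> : map_mx Num.conj G1 *m G1^T = 1%:M.
    apply: trmx_inj; rewrite trmx_mul trmxK trmx1 map_trmx.
    exact/unitarymxP.
  by rewrite mulmx1.
split=> //; split=> //.
(* For [L], [G2] is factored and the product transposed; for [R], [G1^T] is factored directly. *)
- exact/unitary_hessenberg_product_tr/unitary_upper_hessenberg_product/bandwidth_le_lower.
- apply: unitary_upper_hessenberg_product; rewrite ?trmx_unitary //.
  exact/bandwidth_le_lower/bandwidth_le_tr.
(* [F] is the identity plus its correction term, so [Q] and [Qhat] are identities; the splitting of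
   the size is that of [G2]. *)
- exists (\sum_(i < s - 1) (k + k) + k)%N, e2, 1%:M, 1%:M, ((Z^t* *m map_mx Num.conj G1)^t*).
  rewrite trmxCK; split; rewrite ?unitarymx1 //.
    by rewrite -scalar_mx_block castmx_scalar.
  by move=> i j lji; rewrite mxE -val_eqE /= gtn_eqF // ltnW.
Qed.
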